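(* Let $a<b$ be real numbers, $\Omega=(a,b)$, and $\lambda\in\mathbb{C}\setminus[-1,1]$. Let $\frac12<\alpha\le1$, let $u\in C^{\alpha}([a,b])$ satisfy $u(a)=u(b)=0$, and suppose that $u$ is a solution of the singular integral equation $$ \lambda u(x) - \mathrm{p.v.}\!\int_{\Omega}\frac{u(y)}{i\pi(x-y)}dy = f(x)\,,\quad x\in\Omega\,, $$ with right hand side $f$. For every integer $N\ge2$ such that $M:=N(b-a)$ is a positive integer, set $h=\frac1N$, $\omega^N=\{1,\dots,M\}$, $x_m=a+(m-\tfrac12)h$, and let $(u_n)_{n\in\omega^N}$ be the solution of the discrete system $$ \lambda u_{m} - \frac1{i\pi N}\sum_{n\in\omega^{N},\,n\ne m}\frac{u_{n}}{x_{m}-x_{n}}= f(x_{m})\,,\quad m\in\omega^{N}\,. $$ Let $E^N=(E_m)_{m\in\omega^N}$ with $E_m=u(x_m)-u_m$ be the discrete error. Then there is a constant $C$ independent of $N$ such that, for all such $N$, $$ \|E^{N}\|_{\ell^{2}(\omega^{N})} \le C\,N^{\frac12-\alpha}\log N\,. $$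
   Context: $C^\alpha([a,b])$ is the space of complex-valued functions that are H\''older continuous of exponent $\alpha$ on $[a,b]$ (Lipschitz when $\alpha=1$). The notation $\mathrm{p.v.}\int$ denotes the Cauchy principal value integral, i.e. $\lim_{\varepsilon\to0+}\int_{\{y\in\Omega:\,|y-x|>\varepsilon\}}$. The norm on $\ell^2(\omega^N)$ is the unweighted Euclidean norm $\|E\|_{\ell^2(\omega^N)}=\big(\sum_{m\in\omega^N}|E_m|^2\big)^{1/2}$. The points $x_m$ are the midpoints of the $M$ subintervals of length $h$ dividing $(a,b)$; this choice of mesh (with $b-a$ a multiple of $h$) is a standing assumption. *)

(* Defs.v *)
From mathcomp Require Import all_boot all_order all_algebra.
From mathcomp Require Import all_classical all_reals all_analysis.
From mathcomp Require Export complex.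
Set Implicit Arguments.
Unset Strict Implicit.
Unset Printing Implicit Defensive.
Import Order.TTheory GRing.Theory Num.Theory.
Import numFieldNormedType.Exports.
Import ComplexField.
Local Open Scope classical_set_scope.
Local Open Scope ring_scope.
Local Open Scope complex_scope.

(* The modulus as an element of [R]; the library's [`|z|] for [z : R[i]] is the
   same number embedded in [R[i]]. *)
Definition cmod (R : realType) (z : R[i]) : R := Normc.normc z.

(* [u] is a total function, only its values on [[a, b]] are constrained. *)
Definition holder_continuous (R : realType) (alpha a b : R) (u : R -> R[i]) :
    Prop :=
  exists K : R, forall x y : R, a <= x <= b -> a <= y <= b ->
    cmod (u x - u y) <= K * `|x - y| `^ alpha.

(* MathComp-Analysis integrates real-valued functions only, hence the split into
   real and imaginary parts. *)
Definition cintegral (R : realType) (A : set R) (g : R -> R[i]) : R[i] :=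
  Rintegral lebesgue_measure A (fun y => complex.Re (g y))
  +i* Rintegral lebesgue_measure A (fun y => complex.Im (g y)).

(* [l] is the principal value at [x] of the integral of [g] over [(a, b)]. The
   cast to [R[i]^o] selects the norm topology of [R[i]] (as a field normed over
   itself). *)
Definition is_pv_integral (R : realType) (a b x : R) (g : R -> R[i])
    (l : R[i]) : Prop :=
  cintegral [set y | a < y < b /\ eps < `|y - x|] g
    @[eps --> (0 : R)^'+] --> (l : R[i]^o).

Definition solves_singular_equation (R : realType) (a b : R) (lambda : R[i])
    (u f : R -> R[i]) : Prop :=
  forall x : R, a < x < b ->
    exists l : R[i],
      is_pv_integral a b x (fun y => u y / ('i%C * pi%:C * (x - y)%:C)) l /\
      lambda * u x - l = f x.

(* An index [m : 'I_M] runs over [0, ..., M - 1] and stands for the index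
   [m + 1] in [{1, ..., M}], so the midpoint is [a + ((m + 1) - 1/2) h] with
   [h = 1/N]. *)
Definition midpoint (R : realType) (a : R) (N M : nat) (m : 'I_M) : R :=
  a + (m.+1%:R - 2^-1) * N%:R^-1.

Definition solves_discrete_system (R : realType) (a : R) (lambda : R[i])
    (N M : nat) (f : R -> R[i]) (v : 'I_M -> R[i]) : Prop :=
  forall m : 'I_M,
    lambda * v m
    - ('i%C * pi%:C * N%:R)^-1
      * (\sum_(n < M | n != m) v n / (midpoint a N m - midpoint a N n)%:C)
    = f (midpoint a N m).

Definition l2norm (R : realType) (M : nat) (E : 'I_M -> R[i]) : R :=
  Num.sqrt (\sum_(m < M) cmod (E m) ^+ 2).

(* Main.v *)
(* The matrix of the discrete system is [lambda - T], where [T] is the Toeplitz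
   matrix with entries [1 / (i pi (m - n))].  It is Hermitian, and Hilbert's
   inequality places its quadratic form in [[-1, 1]]; so [lambda - T] is bounded
   below by [dist(lambda, [-1, 1])], and the l2 error is controlled by the
   consistency error, the difference between the principal value and its
   midpoint sum.  At a node [x], [u(x)] is subtracted under the integral: the
   remaining integrand is compared cell by cell, which costs [h^alpha / k] at
   distance [k h] and hence [h^alpha log N] in total.  What was subtracted leaves
   [u(x)] times a difference of two values of [H_n - ln (n + 1/2)], of order one
   over the number of cells between [x] and the nearer endpoint, and this is
   compensated by [u] vanishing at the endpoints.  Summing the squares over the
   [N (b - a)] nodes gives the rate [N^(1/2 - alpha) log N]. *)
Require Import Defs.
From mathcomp Require Import all_boot all_order all_algebra.
From mathcomp Require Import all_classical all_reals all_analysis.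
From mathcomp Require Import ring lra.
Import Order.TTheory GRing.Theory Num.Theory.
Import numFieldNormedType.Exports.
Set Implicit Arguments.
Unset Strict Implicit.
Unset Printing Implicit Defensive.
Local Open Scope ring_scope.
Local Open Scope complex_scope.

(** * Increments compared through derivatives *)

(** [G - s *: F] is nondecreasing for [s = 1] and [s = -1]. Working with primitives in this way
    turns every later integral estimate into a pointwise bound on derivatives. *)
Lemma ler_norm_derive_diff (R : realType) (F f G g : R -> R) (a b : R) :
  a <= b ->
  (forall t, a <= t <= b -> is_derive t 1 F (f t)) ->
  (forall t, a <= t <= b -> is_derive t 1 G (g t)) ->
  (forall t, a < t < b -> `|f t| <= g t) ->
  `|F b - F a| <= G b - G a.
Proof.
move=> ab dF dG fg.
have key s : s ^+ 2 = 1 -> s * (F b - F a) <= G b - G a.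
  move=> s1.
  have s1' : `|s| = 1.
    by apply/eqP; rewrite -(@eqrXn2 _ 2)// -normrX s1 expr1n normr1.
  pose H := G - s *: F.
  have dH t : a <= t <= b -> is_derive t 1 H (g t - s *: f t).
    move=> tab; apply: is_deriveB; first exact: dG.
    by apply: is_deriveZ; exact: dF.
  have cH : {within `[a, b], continuous H}%classic.
    apply: derivable_within_continuous => t; rewrite in_itv/= => tab.
    by have [] := dH _ tab.
  have : H a <= H b.
    apply: (@ger0_derive1_le_cc _ _ a b) => //; rewrite ?in_itv/= ?lexx ?ab//.
    - move=> t /andP[at_ tb].
      by have [] // := dH t; rewrite ?ltW.
    - move=> t; rewrite in_itv/= => /andP[at_ tb].
      have tab : a <= t <= b by rewrite !ltW.
      rewrite derive1E (@derive_val _ _ _ _ _ _ _ (dH t tab)).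
      rewrite subr_ge0 (le_trans (ler_norm _))// normrZ s1' mul1r.
      by rewrite fg// at_ tb.
  by rewrite /H !fctE /= /GRing.scale /=; lra.
rewrite ler_norml; apply/andP; split.
  by have := key (-1); rewrite sqrrN expr1n => /(_ erefl); lra.
by have := key 1; rewrite expr1n => /(_ erefl); lra.
Qed.

(** * Harmonic sums against the logarithm *)

Definition harmonic_sum (R : realType) (n : nat) : R :=
  \sum_(k < n) k.+1%:R^-1.

Lemma ln_le_subr1 (R : realType) (x : R) : 0 < x -> ln x <= x - 1.
Proof.
move=> x0; have := @le_ln1Dx R (x - 1); rewrite [1 + _]addrC subrK; apply.
by lra.
Qed.

(** Both sides are [ln t <= t - 1], taken at [t = x / y] and at [t = y / x]. *)
Lemma ln_diff_bounds (R : realType) (x y : R) : 0 < x -> 0 < y ->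
  (y - x) / y <= ln y - ln x <= (y - x) / x.
Proof.
move=> x0 y0; rewrite -ln_div ?posrE//.
have -> : (y - x) / x = y / x - 1 by field; lra.
rewrite ln_le_subr1 ?divr_gt0// andbT.
have : ln (x / y) <= x / y - 1 by rewrite ln_le_subr1 ?divr_gt0.
have -> : (y - x) / y = - (x / y - 1) by field; lra.
by rewrite !ln_div ?posrE//; lra.
Qed.

Lemma harmonic_sum_le (R : realType) n : harmonic_sum R n <= 1 + ln n.+1%:R.
Proof.
rewrite /harmonic_sum; case: n => [|n]; first by rewrite big_ord0 ln1; lra.
suff : \sum_(k < n.+1) k.+1%:R^-1 <= 1 + ln n.+1%:R :> R.
  move=> /le_trans; apply; rewrite lerD2l ler_ln ?posrE ?ltr0n//.
  by rewrite ler_nat.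
elim: n => [|n IH]; first by rewrite big_ord1 invr1 ln1; lra.
rewrite big_ord_recr /=.
have := @ln_diff_bounds R n.+1%:R n.+2%:R (ltr0Sn _ _) (ltr0Sn _ _).
have -> : n.+2%:R - n.+1%:R = 1 :> R by rewrite -natrB// subSnn.
rewrite div1r => /andP[h _]; apply: (le_trans (lerD IH h)).
by rewrite -addrA lerD2l addrC subrK.
Qed.

(* Both [1/k] and [ln ((k + 1/2) / (k - 1/2))] lie between [1 / (k + 1/2)] and
   [1 / (k - 1/2)], so the increments of [H_n - ln (n + 1/2)] telescope. *)
Lemma harmonic_sum_ln_diff (R : realType) (m n : nat) : (m <= n)%N ->
  `|(harmonic_sum R n - ln (n%:R + 2^-1)) - (harmonic_sum R m - ln (m%:R + 2^-1))|
    <= (m%:R + 2^-1)^-1 - (n%:R + 2^-1)^-1.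
Proof.
elim: n => [|n IH]; first by rewrite leqn0 => /eqP->; rewrite !subrr normr0.
rewrite leq_eqVlt => /predU1P[->|]; first by rewrite !subrr normr0.
rewrite ltnS => /IH {}IH.
rewrite /harmonic_sum big_ord_recr /= -/(harmonic_sum R n).
have n0 : 0 <= n%:R :> R by [].
have := @ln_diff_bounds R (n%:R + 2^-1) (n.+1%:R + 2^-1).
rewrite -[n.+1]addn1 natrD.
move: (n%:R) n0 IH => x x0 IH /(_ ltac:(lra) ltac:(lra)).
have -> : x + 1 + 2^-1 - (x + 2^-1) = 1 by lra.
rewrite !div1r => h.
have h1 : (x + 1 + 2^-1)^-1 <= (x + 1)^-1 by rewrite lef_pV2 ?posrE; lra.
have h2 : (x + 1)^-1 <= (x + 2^-1)^-1 by rewrite lef_pV2 ?posrE; lra.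
move: IH; rewrite -/(harmonic_sum R m) !ler_norml => IH; lra.
Qed.

(** * Midpoint quadrature on a half line *)

Lemma powR_natM_le (R : realType) (al h : R) (k : nat) : al <= 1 -> 0 <= h ->
  (k.+1%:R * h) `^ al <= k.+1%:R * h `^ al.
Proof.
move=> al1 h0; rewrite powRM//; apply: ler_wpM2r; first exact: powR_ge0.
by rewrite -[leRHS]powRr1// ler_powR// ler1n.
Qed.

(* Away from the singularity the quotient [(w t - w 0) / t] is compared with its
   midpoint value; on the first half cell Hoelder continuity at [0] makes it
   integrable.  The extra [1/k] per cell produces the harmonic sum. *)
Lemma half_line_quadrature (R : realType) (w Q : R -> R) (K al h eps L : R)
    (q : nat) :
  2^-1 < al <= 1 -> 0 < eps < h / 2 ->
  (forall s t, `|w s - w t| <= K * `|s - t| `^ al) ->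
  (forall t, eps <= t <= L -> is_derive t 1 Q (w t / t)) ->
  (q%:R + 2^-1) * h <= L ->
  `|Q ((q%:R + 2^-1) * h) - Q eps - w 0 * (ln ((q%:R + 2^-1) * h) - ln eps)
    - \sum_(k < q) (w (k.+1%:R * h) - w 0) / k.+1%:R|
  <= K * h `^ al * (2 + 3 * harmonic_sum R q).
Proof.
move=> /andP[al0 al1] /andP[e0 eh] wH dQ.
have h0 : 0 < h by lra.
have K0 : 0 <= K.
  by have := wH 1 0; rewrite subr0 normr1 powR1 mulr1; apply: le_trans.
pose P : R -> R := Q - w 0 *: (@ln R : R -> R).
have dP t : eps <= t <= L -> is_derive t 1 P ((w t - w 0) / t).
  move=> et; rewrite mulrBl; apply: is_deriveB; first exact: dQ.
  by apply: is_deriveZ; apply: is_derive1_ln; case/andP: et; lra.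
have PE s t : Q s - Q t - w 0 * (ln s - ln t) = P s - P t.
  have E r : P r = Q r - w 0 * ln r by [].
  by rewrite !E; lra.
rewrite PE.
elim: q => [|q IH] qL.
  rewrite big_ord0 /harmonic_sum big_ord0 subr0 mulr0 addr0 add0r [2^-1 * h]mulrC.
  (* By the Hoelder bound the quotient is at most [K * t^(al - 1)], of which [G] is a primitive.
     Since [1/2 < al], the factor [1 / al] is below 2; this is the constant 2 of the bound. *)
  pose G : R -> R := (K / al) *: (fun t : R => t `^ al).
  have dG t : eps <= t -> is_derive t 1 G (K / al * (al * t `^ (al - 1))).
    by move=> et; apply: is_deriveZ; apply: is_derive1_powR; lra.
  apply: (@le_trans _ _ (G (h / 2) - G eps)).
    apply: (@ler_norm_derive_diff _ P (fun t => (w t - w 0) / t) G).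
    - exact: ltW.
    - by move=> t /andP[et th]; apply: dP; rewrite et /=; move: qL; lra.
    - by move=> t /andP[et _]; exact: dG.
    - move=> t /andP[et _]; have t0 : 0 < t by lra.
      rewrite normrM normfV (gtr0_norm t0) ler_pdivrMr//.
      rewrite -!mulrA [al^-1 * _]mulrA mulVf ?mul1r ?gt_eqF//; last by lra.
      have -> : t `^ (al - 1) * t = t `^ al.
        rewrite -{2}[t]powRr1 ?ltW// -powRD ?subrK//.
        by apply/implyP => _; rewrite gt_eqF.
      by have := wH t 0; rewrite subr0 (gtr0_norm t0).
  have GE r : G r = K / al * r `^ al by [].
  rewrite !GE.
  have : 0 <= K / al * eps `^ al.
    by rewrite mulr_ge0 ?powR_ge0// divr_ge0//; lra.
  have : K / al * (h / 2) `^ al <= 2 * K * h `^ al.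
    apply: ler_pM; rewrite ?powR_ge0//.
    - by rewrite divr_ge0//; lra.
    - rewrite [2 * K]mulrC ler_wpM2l// -[leRHS]invrK lef_pV2 ?posrE; lra.
    - by apply: ge0_ler_powR; rewrite ?nnegrE; lra.
  by lra.
rewrite big_ord_recr /= /harmonic_sum big_ord_recr /= -/(harmonic_sum R q).
set c := (w (q.+1%:R * h) - w 0) / q.+1%:R.
have q0 : 0 <= q%:R :> R by [].
have k0 : 0 < q.+1%:R :> R by [].
have kE : q.+1%:R = q%:R + 1 :> R by rewrite -addn1 natrD.
have {}IH := IH (le_trans _ qL).
have {IH}/IH IH : (q%:R + 2^-1) * h <= (q.+1%:R + 2^-1) * h.
  by rewrite ler_pM2r// kE; lra.
(* It remains to treat the single cell of width [h] centred at [(q + 1) * h]. *)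
suff H : `|P ((q.+1%:R + 2^-1) * h) - P ((q%:R + 2^-1) * h) - c|
    <= K * h `^ al * (3 * q.+1%:R^-1).
  have -> : forall s : R, P ((q.+1%:R + 2^-1) * h) - P eps - (s + c)
      = (P ((q%:R + 2^-1) * h) - P eps - s)
      + (P ((q.+1%:R + 2^-1) * h) - P ((q%:R + 2^-1) * h) - c) by move=> s; lra.
  apply: (le_trans (ler_normD _ _)); apply: (le_trans (lerD IH H)).
  by rewrite -mulrDr ler_wpM2l ?mulr_ge0 ?powR_ge0// mulrDr addrA.
pose x := q.+1%:R * h.
have x0 : 0 < x by rewrite mulr_gt0.
(* The slope removed is the midpoint value of the quotient; over a cell of width [h] it contributes
   exactly [c]. *)
pose F : R -> R := P - (fun t => (w x - w 0) / x * t).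
pose B := 3 * K * h `^ al / x.
have lin (b t : R) : is_derive t (1 : R) (fun t : R => b * t) b.
  have : is_derive t (1 : R) (b *: (id : R -> R)) (b *: (1 : R)).
    by apply: is_deriveZ; exact: is_derive_id.
  by rewrite [b *: 1]/GRing.scale /= mulr1.
have := @ler_norm_derive_diff R F (fun t => (w t - w 0) / t - (w x - w 0) / x)
  (fun t => B * t) (fun=> B) ((q%:R + 2^-1) * h) ((q.+1%:R + 2^-1) * h).
have -> : F ((q.+1%:R + 2^-1) * h) - F ((q%:R + 2^-1) * h)
    = P ((q.+1%:R + 2^-1) * h) - P ((q%:R + 2^-1) * h) - c.
  have FE r : F r = P r - (w x - w 0) / x * r by [].
  rewrite !FE /c kE /x kE; field; lra.
have -> : B * ((q.+1%:R + 2^-1) * h) - B * ((q%:R + 2^-1) * h)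
    = K * h `^ al * (3 * q.+1%:R^-1).
  rewrite /B kE /x kE; field; lra.
apply.
- by rewrite ler_pM2r// kE; lra.
- by move=> t /andP[t1 t2]; apply: is_deriveB; apply: dP; nra.
move=> t /andP[t1 t2].
have t0 : 0 < t by nra.
have xE : x = (q%:R + 1) * h by rewrite /x kE.
have xt : `|x - t| <= h / 2 by rewrite ler_norml; nra.
have -> : (w t - w 0) / t - (w x - w 0) / x
   = (w t - w x) / t + (w x - w 0) * (x - t) / (t * x) by field; lra.
have tx : t^-1 <= 2 / x.
  rewrite -[leLHS]div1r ler_pdivrMr// mulrAC ler_pdivlMr//; nra.
have b1 : `|w t - w x| <= K * h `^ al.
  apply: (le_trans (wH _ _)); rewrite ler_wpM2l//.
  rewrite distrC; apply: ge0_ler_powR; rewrite ?nnegrE//; lra.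
have b2 : `|w x - w 0| <= q.+1%:R * (K * h `^ al).
  apply: (le_trans (wH _ _)); rewrite subr0 gtr0_norm// mulrCA ler_wpM2l//.
  by apply: powR_natM_le => //; exact: ltW.
have KH : 0 <= K * h `^ al by rewrite mulr_ge0 ?powR_ge0.
apply: (le_trans (ler_normD _ _)).
(* The factor 3 in [B] is 2 + 1: the change of numerator costs 2, because [t >= x / 2] on the cell,
   and the change of denominator costs 1. *)
have -> : B = K * h `^ al * (2 / x) + q.+1%:R * (K * h `^ al) * (h / 2) * (2 / x / x).
  rewrite /B /x; field; lra.
apply: lerD.
  by rewrite normrM normfV (gtr0_norm t0); apply: ler_pM => //;
  rewrite invr_ge0 ltW.
rewrite 2!normrM normfV (gtr0_norm (mulr_gt0 t0 x0)).
apply: ler_pM => //.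
- by rewrite invr_ge0 ltW// mulr_gt0.
- by apply: ler_pM.
- by rewrite invfM ler_wpM2r// invr_ge0 ltW.
Qed.

(** * Primitives, Hoelder extension and the truncated integral *)

Lemma continuous_primitive (R : realType) (g : R -> R) (c : R) :
  continuous g -> exists G : R -> R,
    (forall t, c <= t -> is_derive t 1 G (g t)) /\
    (forall d e, c <= d -> d <= e ->
      Rintegral lebesgue_measure [set` `]d, e[%R] g = G e - G d).
Proof.
move=> cg.
have ig d e : lebesgue_measure.-integrable [set` `[d, e]%R] (EFin \o g).
  apply: continuous_compact_integrable; first exact: segment_compact.
  exact: continuous_subspaceT.
(* Integrating from [c - 1] makes every [t >= c] an interior point, so the derivative is two-sided
   even at [t = c]. *)
exists (fun t => Rintegral lebesgue_measure [set` `[c - 1, t]%R] g); split.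
  move=> t ct; have ct1 : c - 1 < t by lra.
  have [dG G't] := @continuous_FTC1_closed R g (c - 1) t (t + 1)
    ltac:(lra) (ig _ _) ct1 (cg t).
  rewrite derive1E in G't.
  exact: (DeriveDef dG G't).
move=> d e cd de.
have sub : lebesgue_measure.-integrable [set` `]d, e]%R] (EFin \o g).
  apply: (integrableS _ _ _ (ig d e)) => //.
  exact: subset_itv_oc_cc.
rewrite Rintegral_itvB// ?bnd_simp; [|by lra].
apply: Rintegral_itv_bndo_bndc.
apply: (integrableS _ _ _ (ig d e)) => //.
exact: subset_itv_oo_cc.
Qed.

(** For [a <= b] this is the nearest-point projection onto [[a, b]]. It is 1-Lipschitz, so composing
    with it extends a function from [[a, b]] to the line with the same Hoelder constant. *)
Definition clamp (R : realType) (a b y : R) : R := Num.min (Num.max y a) b.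

Lemma clamp_id (R : realType) (a b y : R) : a <= y <= b -> clamp a b y = y.
Proof.
by move=> /andP[ay yb]; rewrite /clamp (max_idPl _)// (min_idPl _).
Qed.

Lemma clamp_itv (R : realType) (a b y : R) : a <= b -> a <= clamp a b y <= b.
Proof.
by move=> ab; rewrite /clamp ge_min lexx orbT le_min ab andbT le_max lexx orbT.
Qed.

Lemma clamp_lipschitz (R : realType) (a b y z : R) : a <= b ->
  `|clamp a b y - clamp a b z| <= `|y - z|.
Proof.
move=> ab; rewrite /clamp /Num.max /Num.min.
have h1 := ler_norm (y - z); have h2 := ler_norm (z - y).
rewrite distrC in h2; rewrite ler_norml.
by case: (ltP y a) => ?; case: (ltP z a) => ?; do ?[case: ltP => ?]; lra.
Qed.

Lemma holder_clamp (R : realType) (v : R -> R) (a b K al : R) :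
  a <= b -> 0 <= al -> 0 <= K ->
  (forall y z, a <= y <= b -> a <= z <= b -> `|v y - v z| <= K * `|y - z| `^ al) ->
  forall y z, `|v (clamp a b y) - v (clamp a b z)| <= K * `|y - z| `^ al.
Proof.
move=> ab al0 K0 vH y z.
apply: (le_trans (vH _ _ (clamp_itv _ ab) (clamp_itv _ ab))).
rewrite ler_wpM2l// ge0_ler_powR ?nnegrE//.
exact: clamp_lipschitz.
Qed.

Lemma holder_continuous_real (R : realType) (v : R -> R) (K al : R) :
  0 < al -> 0 <= K ->
  (forall y z, `|v y - v z| <= K * `|y - z| `^ al) -> continuous v.
Proof.
move=> al0 K0 vH x; apply/cvgrPdist_le => /= e e0.
have K1 : 0 < K + 1 by lra.
pose d := (e / (K + 1)) `^ al^-1.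
have d0 : 0 < d by apply: powR_gt0; exact: divr_gt0.
have : \forall t \near x, `|x - t| <= d.
  by apply/nbhs_ballP; exists d => //= t; rewrite /ball/= => /ltW.
apply: filterS => t xt.
apply: (le_trans (vH _ _)).
have : `|x - t| `^ al <= d `^ al.
  by apply: ge0_ler_powR; rewrite ?nnegrE ?powR_ge0//; exact: ltW.
rewrite /d -powRrM mulVf ?gt_eqF// powRr1; last by rewrite divr_ge0 ?ltW.
move=> h.
apply: (@le_trans _ _ (K * (e / (K + 1)))); first by rewrite ler_wpM2l.
rewrite mulrA ler_pdivrMr//; nra.
Qed.

(** With [x = n + 1/2] the factor in front of [h^al] is [x^(al - 1)], which is at most 1 when
    [x >= 1] and at most 2 at [x = 1/2]. It pairs the Hoelder decay of a function towards a zero at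
    distance [x * h] with a factor [1 / x]. *)
Lemma half_node_powR_le (R : realType) (al h : R) (n : nat) :
  0 <= al <= 1 -> 0 <= h ->
  ((n%:R + 2^-1) * h) `^ al * (n%:R + 2^-1)^-1 <= 2 * h `^ al.
Proof.
move=> /andP[al0 al1] h0.
have n0 : 0 <= n%:R :> R by [].
have x0 : 0 < n%:R + 2^-1 :> R by lra.
have x00 := ltW x0.
rewrite powRM// mulrAC ler_wpM2r ?powR_ge0// ler_pdivrMr//.
have [x1|x1] := leP 1 (n%:R + 2^-1 : R).
  by have := ler_powR x1 al1; rewrite powRr1// => /le_trans; apply; lra.
have : (n%:R + 2^-1) `^ al <= 1 `^ al :> R.
  by apply: ge0_ler_powR; rewrite ?nnegrE// ltW.
by rewrite powR1 => /le_trans; apply; lra.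
Qed.

(* The kernel [1 / s] is replaced by [s / max (eps^2, s^2)], which is continuous
   on the whole line and coincides with it for [eps <= |s|]. *)
Lemma truncated_integral_primitive (R : realType) (v w : R -> R)
    (a b x eps : R) :
  0 < eps -> a <= x - eps -> x + eps <= b ->
  continuous w -> {in `[a, b]%R, v =1 w} ->
  exists G : R -> R,
    (forall t, eps <= t -> a <= x - t ->
      is_derive t 1 (fun t => - G (x - t)) (w (x - t) / t)) /\
    (forall t, eps <= t ->
      is_derive t 1 (fun t => - G (x + t)) (w (x + t) / t)) /\
    Rintegral lebesgue_measure [set y | a < y < b /\ eps < `|y - x|]%classic
      (fun y => v y / (x - y)) = G (x - eps) - G a + (G b - G (x + eps)).
Proof.
move=> e0 axe xeb cw vw.
pose den (y : R) : R := Num.max (eps ^+ 2) ((x - y) ^+ 2).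
pose g (y : R) : R := w y * (x - y) * (den y)^-1.
have den0 y : 0 < den y by rewrite /den lt_max exprn_gt0.
have cs : continuous (fun y : R => x - y).
  by move=> y; apply: continuousB; [exact: cst_continuous|exact: cvg_id].
have cg : continuous g.
  have cden : continuous den.
    move=> y; apply: (@continuous_max _ _ (cst (eps ^+ 2)) (fun y => (x - y) ^+ 2)).
      exact: cst_continuous.
    exact: (@continuousM _ _ (fun y => x - y) (fun y => x - y) y (cs y) (cs y)).
  move=> y; apply: (@continuousM _ _ (fun y => w y * (x - y))).
    exact: (@continuousM _ _ w (fun y => x - y) y (cw y) (cs y)).
  by apply: (@continuousV _ _ den); [rewrite gt_eqF|exact: cden].
(* The sign [s] selects the side of [x]. The sign of the kernel and that of the chain rule combine
   so that both sides get the same derivative form in the distance [t]. *)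
have gE s t : eps <= t -> s ^+ 2 = 1 -> g (x + s * t) = - s * (w (x + s * t) / t).
  move=> et s1; rewrite /g /den.
  have -> : x - (x + s * t) = - s * t by ring.
  rewrite max_r ?exprMn ?sqrrN ?s1 ?mul1r; first by field; lra.
  by rewrite ler_pXn2r ?nnegrE//; lra.
have [G [dG iG]] := continuous_primitive a cg.
exists G; split; last split.
- move=> t et at_.
  have := gE (-1) t et; rewrite sqrrN expr1n => /(_ erefl).
  rewrite mulN1r opprK mul1r => gt_.
  have dx : is_derive t (1 : R) (fun t : R => x - t) (0 - 1).
    exact: is_deriveB.
  have dGx : is_derive (x - t) (1 : R) G (g (x - t)) by exact: dG.
  have := is_deriveN (@is_derive1_comp R G (fun t => x - t) t _ _ dGx dx).
  by rewrite gt_ sub0r mulrN1 opprK.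
- move=> t et.
  have := gE 1 t et; rewrite expr1n => /(_ erefl).
  rewrite mulN1r mul1r => gt_.
  have dx : is_derive t (1 : R) (fun t : R => x + t) (0 + 1).
    exact: is_deriveD.
  have dGx : is_derive (x + t) (1 : R) G (g (x + t)) by apply: dG; lra.
  have := is_deriveN (@is_derive1_comp R G (fun t => x + t) t _ _ dGx dx).
  by rewrite gt_ add0r mulr1 opprK.
have -> : [set y | a < y < b /\ eps < `|y - x|]%classic
    = ([set` `]a, (x - eps)[%R] `|` [set` `](x + eps), b[%R])%classic.
  apply/seteqP; split => y /=; rewrite !in_itv/= ltr_normr.
    by case=> h1 /orP[h2|h2]; [right|left]; lra.
  by case=> h1; split; lra.
set D := (_ `|` _)%classic.
have vg : {in D, (fun y => v y / (x - y)) =1 g}.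
  move=> y; rewrite inE /D/= !in_itv/= => yD.
  have yab : y \in `[a, b]%R by rewrite in_itv/=; lra.
  rewrite (vw _ yab) /g /den max_r; last first.
    rewrite -[leRHS]real_normK ?num_real// ler_pXn2r ?nnegrE ?(ltW e0)//.
    by rewrite ler_normr; lra.
  by field; apply/negP => /eqP ?; lra.
transitivity (Rintegral lebesgue_measure D g); first exact: eq_Rintegral.
rewrite /D.
rewrite Rintegral_setU.
- by rewrite !iG//; lra.
- exact: measurable_itv.
- exact: measurable_itv.
- have ig : lebesgue_measure.-integrable [set` `[a, b]%R] (EFin \o g).
    apply: continuous_compact_integrable; first exact: segment_compact.
    exact: continuous_subspaceT.
  apply: (integrableS _ _ _ ig).
  + exact: measurable_itv.
  + by apply: measurableU; exact: measurable_itv.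
  + by move=> y /=; rewrite !in_itv/=; lra.
- by apply/disj_setPS => y /=; rewrite !in_itv/=; lra.
Qed.

(** * The truncated integral against its midpoint sum *)

(** The half-line estimate is applied on each side of [x]. In the difference the terms
    [ln h - ln eps] cancel, so the bound is uniform in [eps]; the constant 6 collects 2 from each
    side and 2 from the remaining multiple of [v x]. *)
Lemma pv_quadrature (R : realType) (v : R -> R) (a b K al h x eps : R)
    (p q : nat) :
  2^-1 < al <= 1 -> 0 <= K -> 0 < eps < h / 2 ->
  x = a + (p%:R + 2^-1) * h -> b = x + (q%:R + 2^-1) * h ->
  (forall y z, a <= y <= b -> a <= z <= b -> `|v y - v z| <= K * `|y - z| `^ al) ->
  v a = 0 -> v b = 0 ->
  `|Rintegral lebesgue_measure [set y | a < y < b /\ eps < `|y - x|]%classic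
      (fun y => v y / (x - y))
    - (\sum_(k < p) v (x - k.+1%:R * h) / k.+1%:R
       - \sum_(k < q) v (x + k.+1%:R * h) / k.+1%:R)|
  <= K * h `^ al * (6 + 3 * (harmonic_sum R p + harmonic_sum R q)).
Proof.
move=> al01 K0 eh xE bE vH va vb.
have h0 : 0 < h by lra.
have p0 : 0 <= p%:R :> R by [].
have q0 : 0 <= q%:R :> R by [].
have ep : eps <= (p%:R + 2^-1) * h by nra.
have eq : eps <= (q%:R + 2^-1) * h by nra.
have axb : a <= x <= b by lra.
pose w y := v (clamp a b y).
have al0 : 0 < al by lra.
have ab : a <= b by lra.
have wH := holder_clamp ab (ltW al0) K0 vH.
have vw : {in `[a, b]%R, v =1 w}.
  by move=> y; rewrite in_itv/= => yab; rewrite /w clamp_id.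
have [G [dl [dr ->]]] := @truncated_integral_primitive R v w a b x eps
  ltac:(lra) ltac:(lra) ltac:(lra) (holder_continuous_real al0 K0 wH) vw.
have wx : w x = v x by rewrite vw ?in_itv.
have Hl := @half_line_quadrature R (fun t => w (x - t)) (fun t => - G (x - t))
  K al h eps ((p%:R + 2^-1) * h) p al01 eh.
have {}Hl := Hl _ _ (lexx _).
have Hr := @half_line_quadrature R (fun t => w (x + t)) (fun t => - G (x + t))
  K al h eps ((q%:R + 2^-1) * h) q al01 eh.
have {}Hr := Hr _ _ (lexx _).
move: Hl Hr; rewrite subr0 addr0 wx.
have -> : x - (p%:R + 2^-1) * h = a by rewrite xE; ring.
rewrite -bE.
have sumE (e : nat -> R) n : (forall k, (k < n)%N -> a <= e k <= b) ->
    \sum_(k < n) (w (e k) - v x) / k.+1%:R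
    = \sum_(k < n) v (e k) / k.+1%:R - v x * harmonic_sum R n.
  move=> H; rewrite /harmonic_sum mulr_sumr -sumrB; apply: eq_bigr => k _.
  by rewrite mulrBl -vw// in_itv/= H.
have Sl := sumE (fun k => x - k.+1%:R * h) p.
have Sr := sumE (fun k => x + k.+1%:R * h) q.
have Pl k : (k < p)%N -> a <= x - k.+1%:R * h <= b.
  rewrite -(ler_nat R) => kp.
  by have : 0 <= k.+1%:R :> R by []; nra.
have Pr k : (k < q)%N -> a <= x + k.+1%:R * h <= b.
  rewrite -(ler_nat R) => kp.
  by have : 0 <= k.+1%:R :> R by []; nra.
rewrite (Sl Pl) (Sr Pr) !lnM ?posrE//.
move=> Hl Hr.
have {}Hl : `|- G a - - G (x - eps) - v x * (ln (p%:R + 2^-1) + ln h - ln eps)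
   - (\sum_(k < p) v (x - k.+1%:R * h) / k.+1%:R - v x * harmonic_sum R p)|
   <= K * h `^ al * (2 + 3 * harmonic_sum R p).
  apply: Hl.
    move=> s t; have := wH (x - s) (x - t).
    by have -> : x - s - (x - t) = - (s - t); [ring | rewrite normrN].
  by move=> t /andP[et tp]; apply: dl => //; rewrite xE; lra.
have {}Hr : `|- G b - - G (x + eps) - v x * (ln (q%:R + 2^-1) + ln h - ln eps)
   - (\sum_(k < q) v (x + k.+1%:R * h) / k.+1%:R - v x * harmonic_sum R q)|
   <= K * h `^ al * (2 + 3 * harmonic_sum R q).
  apply: Hr.
    move=> s t; have := wH (x + s) (x + t).
    by have -> : x + s - (x + t) = s - t by ring.
  by move=> t /andP[et _]; exact: dr.
have Hv : `|v x * ((harmonic_sum R q - ln (q%:R + 2^-1))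
    - (harmonic_sum R p - ln (p%:R + 2^-1)))| <= K * h `^ al * 2.
  have aux n (z u : R) : a <= z <= b -> v z = 0 ->
      `|x - z| = (n%:R + 2^-1) * h -> `|u| <= (n%:R + 2^-1)^-1 ->
      `|v x * u| <= K * h `^ al * 2.
    move=> zab vz xz uH; rewrite normrM.
    have := vH x z axb zab; rewrite vz subr0 xz => vx.
    apply: (le_trans (ler_pM _ _ vx uH)) => //.
    rewrite -!mulrA ler_wpM2l// [leRHS]mulrC; apply: half_node_powR_le; lra.
  have inv0 (y : R) : 0 <= y -> 0 <= (y + 2^-1)^-1.
    by move=> y0; rewrite invr_ge0; lra.
  (* The nearer endpoint is used: the smaller of [p] and [q] governs both the harmonic difference
     and the smallness of [v x]. *)
  have [pq|/ltnW qp] := leqP p q.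
    apply: (aux p a) => //; first by rewrite lexx.
      by rewrite xE gtr0_norm; nra.
    apply: (le_trans (harmonic_sum_ln_diff R pq)).
    by rewrite lerBlDr lerDl inv0.
  apply: (aux q b) => //; first by rewrite ab lexx.
    by rewrite bE distrC gtr0_norm; nra.
  rewrite distrC; apply: (le_trans (harmonic_sum_ln_diff R qp)).
  by rewrite lerBlDr lerDl inv0.
move: Hl Hr Hv; rewrite !ler_norml; lra.
Qed.

(** * Hilbert's inequality *)

Lemma cos_sin_nat_2pi (R : realType) (m n : nat) :
  cos ((m%:R - n%:R) * (2 * pi)) = 1 :> R /\
  sin ((m%:R - n%:R) * (2 * pi)) = 0 :> R.
Proof.
have E k : k%:R * (2 * pi) = 0 + (pi *+ 2) *+ k :> R.
  by rewrite add0r -[RHS]mulr_natl -[pi *+ 2]mulr_natl.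
have c k : cos (k%:R * (2 * pi)) = 1 :> R.
  by rewrite E (periodicn (@cosD2pi R)) cos0.
have s k : sin (k%:R * (2 * pi)) = 0 :> R.
  by rewrite E (periodicn (@sinD2pi R)) sin0.
by rewrite mulrBl cosB sinB !c !s; split; ring.
Qed.

(** The primitive comes from integration by parts; the derivative is an off-diagonal term of
    [t * |P(t)|^2] for a trigonometric polynomial [P], with [k] the difference of two
    frequencies. *)
Lemma is_derive_moment (R : realType) (k a d t : R) : k != 0 ->
  is_derive t 1 (fun t => a * (t * sin (k * t) / k + cos (k * t) / k ^+ 2)
      + d * (t * cos (k * t) / k - sin (k * t) / k ^+ 2))
    (t * (a * cos (k * t) - d * sin (k * t))).
Proof.
move=> k0.
pose s : R -> R := fun t => sin (k * t).
pose c : R -> R := fun t => cos (k * t).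
have dk : is_derive t (1 : R) (fun t : R => k * t) k.
  have : is_derive t (1 : R) (k *: (id : R -> R)) (k *: (1 : R)).
    by apply: is_deriveZ; exact: is_derive_id.
  by rewrite [k *: 1]/GRing.scale /= mulr1.
have ds : is_derive t (1 : R) s (cos (k * t) * k).
  exact: (@is_derive1_comp R sin (fun t => k * t) t _ _ (is_derive_sin _) dk).
have dc : is_derive t (1 : R) c (- sin (k * t) * k).
  exact: (@is_derive1_comp R cos (fun t => k * t) t _ _ (is_derive_cos _) dk).
have -> : (fun t => a * (t * sin (k * t) / k + cos (k * t) / k ^+ 2)
      + d * (t * cos (k * t) / k - sin (k * t) / k ^+ 2))
    = (a / k) *: ((id : R -> R) * s) + (a / k ^+ 2) *: c
      + (d / k) *: ((id : R -> R) * c) - (d / k ^+ 2) *: s.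
  apply/funext => r; rewrite !fctE /GRing.scale /= /s /c; ring.
have did := is_derive_id t (1 : R).
have H := is_deriveB (is_deriveD (is_deriveD
    (is_deriveZ (a / k) (is_deriveM did ds)) (is_deriveZ (a / k ^+ 2) dc))
    (is_deriveZ (d / k) (is_deriveM did dc))) (is_deriveZ (d / k ^+ 2) ds).
apply: (is_derive_eq H).
by rewrite /GRing.scale /= /s /c; field.
Qed.

(* With [z = x + i y] and [P(t) = \sum_n z_n e^(int)], the left-hand side times
   [2 pi] is the integral of [t |P(t)|^2] over [[0, 2 pi]]; [F] is an explicit
   primitive. *)
Lemma hilbert_inequality_half (R : realType) (M : nat) (x y : 'I_M -> R) :
  0 <= pi * (\sum_m (x m ^+ 2 + y m ^+ 2))
    + \sum_m \sum_(n < M | n != m) (y m * x n - x m * y n) / (m%:R - n%:R).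
Proof.
pose a (m n : 'I_M) := x m * x n + y m * y n.
pose d (m n : 'I_M) := y m * x n - x m * y n.
pose k (m n : 'I_M) : R := m%:R - n%:R.
pose Phi (m n : 'I_M) : R -> R := if n == m then fun t => a m n * (t ^+ 2 / 2)
  else fun t => a m n * (t * sin (k m n * t) / k m n + cos (k m n * t) / k m n ^+ 2)
      + d m n * (t * cos (k m n * t) / k m n - sin (k m n * t) / k m n ^+ 2).
have k0 m n : n != m -> k m n != 0.
  by rewrite /k subr_eq0 eqr_nat eq_sym.
have dPhi (m n : 'I_M) (t : R) : is_derive t (1 : R) (Phi m n)
    (t * (a m n * cos (k m n * t) - d m n * sin (k m n * t))).
  rewrite /Phi; case: (eqVneq n m) => [->|nm]; last exact: is_derive_moment (k0 _ _ nm).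
  rewrite /k subrr mul0r cos0 sin0.
  have -> : (fun t => a m m * (t ^+ 2 / 2)) = (a m m / 2) *: ((id : R -> R) * id).
    by apply/funext => r; rewrite !fctE /GRing.scale /=; ring.
  by apply: is_derive_eq; rewrite /GRing.scale /=; field.
pose F : R -> R := \sum_m \sum_n Phi m n.
have dF (t : R) : is_derive t (1 : R) F
    (\sum_m \sum_n t * (a m n * cos (k m n * t) - d m n * sin (k m n * t))).
  by apply: is_derive_sum => m; apply: is_derive_sum => n.
(* The two squares are those of the real and imaginary parts of [P(t)], whence the sign of the
   derivative. *)
have F'E t : \sum_m \sum_n t * (a m n * cos (k m n * t) - d m n * sin (k m n * t))
    = t * ((\sum_m (x m * cos (m%:R * t) - y m * sin (m%:R * t))) ^+ 2
         + (\sum_m (x m * sin (m%:R * t) + y m * cos (m%:R * t))) ^+ 2).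
  rewrite !expr2 !big_distrlr /= -big_split /= mulr_sumr; apply: eq_bigr => m _.
  rewrite -big_split /= mulr_sumr; apply: eq_bigr => n _.
  by rewrite /a /d /k mulrBl cosB sinB; ring.
have pi0 := pi_gt0 R.
have := @ler_norm_derive_diff R (cst 0) (fun=> 0) F _ 0 (2 * pi) ltac:(lra)
  (fun t _ => is_derive_cst _ _ _) (fun t _ => dF t).
move=> H.
have {}H : 0 <= F (2 * pi) - F 0.
  apply: (le_trans (normr_ge0 _) (H _)) => t /andP[t0 _]; rewrite F'E normr0.
  by rewrite mulr_ge0 ?(ltW t0)// addr_ge0// sqr_ge0.
(* At both ends the sines vanish and the cosines equal 1, so the [1 / k^2] terms cancel. The weight
   [t] is what keeps [2 * pi * d / k] off the diagonal; the diagonal gives [a * (2 * pi)^2 / 2]. *)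
have FE : F (2 * pi) - F 0 = 2 * pi * (pi * (\sum_m (x m ^+ 2 + y m ^+ 2))
    + \sum_m \sum_(n < M | n != m) d m n / k m n).
  rewrite /F !fct_sumE -sumrB mulr_sumr -big_split mulr_sumr /=.
  apply: eq_bigr => m _; rewrite !fct_sumE -sumrB (bigD1 m) //=.
  rewrite [RHS]mulrDr mulr_sumr; congr (_ + _).
    by rewrite /Phi eqxx /a; field.
  apply: eq_bigr => n nm; rewrite /Phi (negbTE nm).
  have [-> ->] := cos_sin_nat_2pi R m n.
  rewrite [k m n * 0]mulr0 cos0 sin0; field; exact: k0.
by move: H; rewrite FE pmulr_rge0//; lra.
Qed.

(** Exchanging [x] and [y] flips the sign of the double sum and preserves the sum of squares, so the
    one-sided bound gives both sides. *)
Lemma hilbert_inequality (R : realType) (M : nat) (x y : 'I_M -> R) :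
  `|\sum_m \sum_(n < M | n != m) (x m * y n - y m * x n) / (m%:R - n%:R)|
  <= pi * \sum_m (x m ^+ 2 + y m ^+ 2).
Proof.
have H1 := hilbert_inequality_half x y; have H2 := hilbert_inequality_half y x.
have E : \sum_m \sum_(n < M | n != m) (y m * x n - x m * y n) / (m%:R - n%:R)
   = - \sum_m \sum_(n < M | n != m) (x m * y n - y m * x n) / (m%:R - n%:R).
  rewrite -sumrN; apply: eq_bigr => m _; rewrite -sumrN; apply: eq_bigr => n _.
  by rewrite -[RHS]mulNr opprB.
have S : \sum_m (y m ^+ 2 + x m ^+ 2) = \sum_m (x m ^+ 2 + y m ^+ 2).
  by apply: eq_bigr => m _; rewrite addrC.
rewrite E in H1; rewrite S in H2; rewrite ler_norml; lra.
Qed.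


(** * Consistency at a node for real functions *)

(** Indexing by the distance [k + 1] to [m] brings the sum over nodes into the shape of the two
    half-line sums. *)
Lemma sum_ord_neq (V : zmodType) (M : nat) (m : 'I_M) (F : nat -> V) :
  \sum_(n < M | n != m) F n
  = \sum_(k < m) F (m - k.+1)%N + \sum_(k < M - m.+1) F (m + k.+1)%N.
Proof.
have mM := ltn_ord m.
apply: (@addrI _ (F m)); rewrite -(bigD1 m (P := xpredT) (F := fun i : 'I_M => F i))//=.
rewrite -(big_mkord xpredT F) (big_cat_nat (leq0n m) (ltnW mM)) /=.
rewrite (big_ltn mM) addrCA; congr (_ + (_ + _)).
  rewrite big_mkord (reindex_inj rev_ord_inj) /=.
  by apply: eq_bigr.
rewrite -{1}[m.+1]add0n big_addn big_mkord; apply: eq_bigr => k _.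
by rewrite addnC addSnnS.
Qed.

Lemma midpoint_diff (R : realType) (a : R) (N M : nat) (m n : 'I_M) :
  midpoint a N m - midpoint a N n = (m%:R - n%:R) / N%:R.
Proof. by rewrite /midpoint -(addn1 m) -(addn1 n) !natrD; ring. Qed.

Lemma real_consistency (R : realType) (a b K al : R) (v : R -> R) (N M : nat)
    (m : 'I_M) (eps : R) :
  2^-1 < al <= 1 -> 0 <= K -> (0 < N)%N -> M%:R = N%:R * (b - a) ->
  0 < eps < N%:R^-1 / 2 ->
  (forall y z, a <= y <= b -> a <= z <= b -> `|v y - v z| <= K * `|y - z| `^ al) ->
  v a = 0 -> v b = 0 ->
  `|Rintegral lebesgue_measure
      [set y | a < y < b /\ eps < `|y - midpoint a N m|]%classic
      (fun y => v y / (midpoint a N m - y))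
    - \sum_(n < M | n != m) v (midpoint a N n) / (m%:R - n%:R)|
  <= K * N%:R^-1 `^ al * (12 + 6 * ln M%:R).
Proof.
move=> al01 K0 N0 MN eh vH va vb.
have mM := ltn_ord m.
set x := midpoint a N m; set h : R := N%:R^-1.
have Nr : 0 < N%:R :> R by rewrite ltr0n.
have MR : M%:R = m%:R + (M - m.+1)%:R + 1 :> R.
  by rewrite -natrD natr1 -addSn subnKC.
have xE : x = a + (m%:R + 2^-1) * h by rewrite /x /midpoint -[m.+1]addn1 natrD; congr (_ + _ * _); lra.
have bE : b = x + ((M - m.+1)%:R + 2^-1) * h.
  have : b - a = M%:R * h by rewrite MN /h mulrAC mulfV ?mul1r// gt_eqF.
  by rewrite MR xE; lra.
have := pv_quadrature al01 K0 eh xE bE vH va vb.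
have -> : \sum_(k < m) v (x - k.+1%:R * h) / k.+1%:R
    - \sum_(k < M - m.+1) v (x + k.+1%:R * h) / k.+1%:R
    = \sum_(n < M | n != m) v (midpoint a N n) / (m%:R - n%:R).
  pose F n := v (a + (n.+1%:R - 2^-1) / N%:R) / (m%:R - n%:R).
  rewrite (sum_ord_neq m F) -sumrN; congr (_ + _); apply: eq_bigr => k _; rewrite /F.
    have kE : m%:R = (m - k.+1)%:R + k.+1%:R :> R by rewrite -natrD subnK.
    rewrite /x /midpoint -[m.+1%:R]natr1 -[(m - k.+1).+1%:R]natr1 kE.
    by congr (v _ / _); rewrite /h; ring.
  rewrite /x /midpoint -[m.+1%:R]natr1 -[(m + k.+1).+1%:R]natr1 natrD.
  have -> : m%:R - (m%:R + k.+1%:R) = - k.+1%:R :> R by ring.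
  by rewrite invrN mulrN; congr (- (v _ / _)); rewrite /h; ring.
move=> /le_trans; apply; rewrite ler_wpM2l ?mulr_ge0 ?powR_ge0//.
(* Both harmonic sums have fewer than [M] terms, and [6 + 3 * 2 * (1 + ln M) = 12 + 6 * ln M]. *)
have H n : (n < M)%N -> harmonic_sum R n <= 1 + ln M%:R.
  move=> nM; apply: (le_trans (harmonic_sum_le R n)); rewrite lerD2l.
  by rewrite ler_ln ?posrE ?ltr0n ?(leq_trans _ nM)// ler_nat.
have := H m mM; have := H (M - m.+1)%N; rewrite ltn_subrL /= (leq_trans _ mM)//.
by move=> /(_ isT); lra.
Qed.

(** * Splitting into real and imaginary parts *)

Lemma sum_complex (R : rcfType) (I : Type) (r : seq I) (P : pred I) (F G : I -> R) :
  \sum_(i <- r | P i) (F i +i* G i)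
  = (\sum_(i <- r | P i) F i) +i* (\sum_(i <- r | P i) G i).
Proof. by elim/big_rec3: _ => // i x y z _ ->. Qed.

Lemma div_i_real (R : realType) (z : R[i]) (c t : R) :
  z / ('i%C * c%:C * t%:C)
  = (complex.Im z / c / t) +i* (- complex.Re z / c / t).
Proof.
(* As the inverse of 0 is 0, the identity survives a vanishing denominator; it can thus be used
   under the integral for every [y], the node included. *)
have [->|c0] := eqVneq c 0; first by rewrite !(invr0, mulr0, mul0r).
have [->|t0] := eqVneq t 0; first by rewrite !(invr0, mulr0).
have ne0 : 'i%C * c%:C * t%:C != 0.
  by rewrite !mulf_eq0 !eq_complex /= oner_eq0 andbF eqxx (negbTE c0) (negbTE t0).
apply: (mulIf ne0); rewrite divfK//.
by case: z => X Y; apply/eqP; rewrite eq_complex /=; apply/andP; split;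
  apply/eqP; field; rewrite t0.
Qed.

(** The factor [N] cancels the mesh width, so the matrix entries depend on [m - n] only. *)
Lemma discrete_operatorE (R : realType) (a : R) (N M : nat) (z : 'I_M -> R[i])
    (m : 'I_M) : (0 < N)%N ->
  ('i%C * pi%:C * N%:R)^-1
    * (\sum_(n < M | n != m) z n / (midpoint a N m - midpoint a N n)%:C)
  = (\sum_(n < M | n != m) complex.Im (z n) / pi / (m%:R - n%:R))
    +i* (\sum_(n < M | n != m) - complex.Re (z n) / pi / (m%:R - n%:R)).
Proof.
move=> N0; have Nr : N%:R != 0 :> R by rewrite pnatr_eq0 -lt0n.
rewrite mulr_sumr -sum_complex; apply: eq_bigr => n _.
rewrite -div_i_real midpoint_diff.
rewrite mulrCA -invfM; congr (_ / _).
rewrite -!mulrA; congr (_ * (_ * _)).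
by rewrite -(rmorph_nat (real_complex R)) -rmorphM /= mulrC divfK.
Qed.

Lemma cmodE (R : realType) (z : R[i]) :
  cmod z ^+ 2 = complex.Re z ^+ 2 + complex.Im z ^+ 2.
Proof. by case: z => X Y; rewrite /cmod /= sqr_sqrtr// addr_ge0// sqr_ge0. Qed.

Lemma cmod_ge0 (R : realType) (z : R[i]) : 0 <= cmod z.
Proof. by case: z => X Y; exact: sqrtr_ge0. Qed.

Lemma ReIm_le_cmod (R : realType) (z : R[i]) :
  `|complex.Re z| <= cmod z /\ `|complex.Im z| <= cmod z.
Proof.
have := cmodE z; have := cmod_ge0 z => z0 zE.
split; rewrite -(@ler_pXn2r _ 2)// ?nnegrE// real_normK ?num_real// zE.
  by rewrite lerDl sqr_ge0.
by rewrite lerDr sqr_ge0.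
Qed.

(** * Stability of the discrete system *)

Lemma sum_antisym (R : numDomainType) (M : nat) (F : 'I_M -> 'I_M -> R) :
  (forall m n, F n m = - F m n) -> \sum_m \sum_(n < M | n != m) F m n = 0.
Proof.
move=> FN; set S := (X in X = 0).
have : S = - S.
  rewrite {1}/S (exchange_big_dep xpredT)//= /S -sumrN; apply: eq_bigr => m _.
  rewrite -sumrN; apply: eq_big => [n|n _]; first by rewrite eq_sym.
  exact: FN.
by move=> SN; apply/eqP; rewrite -[_ == 0](mulrn_eq0 _ 2) mulr2n {1}SN addNr.
Qed.

(** Completing the square, once for each sign [s]. The weight is chosen so that, after summation,
    half of [d * S] can be absorbed on the left. *)
Lemma young_weighted (R : realFieldType) (d a b x y : R) : 0 < d ->
  `|a * x + b * y| <= (a ^+ 2 + b ^+ 2) / (2 * d) + d / 2 * (x ^+ 2 + y ^+ 2).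
Proof.
move=> d0.
have E s : (a ^+ 2 + b ^+ 2) / (2 * d) + d / 2 * (x ^+ 2 + y ^+ 2) - s * (a * x + b * y)
   = ((a - s * (d * x)) ^+ 2 + (b - s * (d * y)) ^+ 2) / (2 * d)
     + (1 - s ^+ 2) * (d / 2 * (x ^+ 2 + y ^+ 2)) by field; lra.
have key s : s ^+ 2 = 1 ->
   s * (a * x + b * y) <= (a ^+ 2 + b ^+ 2) / (2 * d) + d / 2 * (x ^+ 2 + y ^+ 2).
  move=> s1; rewrite -subr_ge0 E s1 subrr mul0r addr0.
  by rewrite divr_ge0 ?addr_ge0 ?sqr_ge0//; lra.
have := key 1; have := key (-1); rewrite sqrrN !expr1n => /(_ erefl) h1 /(_ erefl) h2.
rewrite ler_norml; lra.
Qed.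

(* The quadratic form of the discrete operator is real and, by Hilbert's
   inequality, bounded by [S = \sum |E_m|^2]; hence pairing the equation with the
   conjugate of [E] bounds [dist(lambda, [-1, 1]) * S]. *)
Lemma discrete_stability (R : realType) (lambda : R[i]) :
  (forall t : R, -1 <= t <= 1 -> lambda <> t%:C) ->
  exists2 d : R, 0 < d & forall (M : nat) (E r : 'I_M -> R[i]),
    (forall m, lambda * E m -
       ((\sum_(n < M | n != m) complex.Im (E n) / pi / (m%:R - n%:R))
        +i* (\sum_(n < M | n != m) - complex.Re (E n) / pi / (m%:R - n%:R)))
       = r m) ->
    d ^+ 2 * \sum_m cmod (E m) ^+ 2 <= \sum_m cmod (r m) ^+ 2.
Proof.
case: lambda => p q hl.
(* Off the real axis [d = |q|], and the imaginary part of the form is used; on it [d = |p| - 1], and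
   the real part is used together with Hilbert's inequality. *)
have [d d0 hd] : exists2 d : R, 0 < d & d <= `|q| \/ d <= `|p| - 1.
  have [q0|q0] := eqVneq q 0; last by exists `|q|; [rewrite normr_gt0|left].
  exists (`|p| - 1); last by right.
  rewrite subr_gt0 ltNge; apply/negP; rewrite ler_norml => /hl; apply.
  by rewrite q0.
exists d => // M E r Er.
pose x m := complex.Re (E m); pose y m := complex.Im (E m).
pose a m := complex.Re (r m); pose b m := complex.Im (r m).
pose S := \sum_m (x m ^+ 2 + y m ^+ 2); pose T := \sum_m (a m ^+ 2 + b m ^+ 2).
have -> : \sum_m cmod (E m) ^+ 2 = S by apply: eq_bigr => m _; rewrite cmodE.
have -> : \sum_m cmod (r m) ^+ 2 = T by apply: eq_bigr => m _; rewrite cmodE.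
have S0 : 0 <= S by apply: sumr_ge0 => m _; rewrite addr_ge0 ?sqr_ge0.
have aE m : a m = p * x m - q * y m - \sum_(n < M | n != m) y n / pi / (m%:R - n%:R).
  by rewrite /a -Er /x /y; case: (E m).
have bE m : b m = p * y m + q * x m - \sum_(n < M | n != m) - x n / pi / (m%:R - n%:R).
  by rewrite /b -Er /x /y; case: (E m).
pose W := \sum_m \sum_(n < M | n != m) (x m * y n - y m * x n) / (m%:R - n%:R).
have pi0 := pi_gt0 R.
have reE : \sum_m (a m * x m + b m * y m) = p * S - pi^-1 * W.
  rewrite /S /W !mulr_sumr -sumrB; apply: eq_bigr => m _.
  rewrite aE bE mulr_sumr.
  have -> : \sum_(n < M | n != m) pi^-1 * ((x m * y n - y m * x n) / (m%:R - n%:R))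
     = x m * (\sum_(n < M | n != m) y n / pi / (m%:R - n%:R))
     + y m * (\sum_(n < M | n != m) - x n / pi / (m%:R - n%:R)).
    rewrite !mulr_sumr -big_split /=; apply: eq_bigr => n _; ring.
  ring.
have imE : \sum_m (b m * x m + (- a m) * y m) = q * S.
  (* The added double sum is zero: its numerator is symmetric in [m] and [n] and its denominator
     antisymmetric. Hence the discrete operator contributes nothing to the imaginary part. *)
  have <- : q * S + \sum_m \sum_(n < M | n != m)
      (x m * x n + y m * y n) / (m%:R - n%:R) / pi = q * S.
    rewrite sum_antisym ?addr0// => m n.
    by rewrite -(opprB m%:R n%:R) invrN mulrN mulNr [x n * _]mulrC [y n * _]mulrC.
  rewrite /S mulr_sumr -big_split /=; apply: eq_bigr => m _.
  rewrite aE bE.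
  have -> : \sum_(n < M | n != m) (x m * x n + y m * y n) / (m%:R - n%:R) / pi
     = y m * (\sum_(n < M | n != m) y n / pi / (m%:R - n%:R))
     - x m * (\sum_(n < M | n != m) - x n / pi / (m%:R - n%:R)).
    rewrite !mulr_sumr -sumrB /=; apply: eq_bigr => n _; ring.
  ring.
have HW : `|W| <= pi * S := hilbert_inequality x y.
have bound (F : 'I_M -> R) : (forall m, `|F m| <= (a m ^+ 2 + b m ^+ 2) / (2 * d)
     + d / 2 * (x m ^+ 2 + y m ^+ 2)) -> `|\sum_m F m| <= T / (2 * d) + d / 2 * S.
  move=> HF; apply: (le_trans (ler_norm_sum _ _ _)).
  by rewrite /T /S mulr_suml mulr_sumr -big_split /=; apply: ler_sum => m _.
have B1 := bound _ (fun m => young_weighted (a m) (b m) (x m) (y m) d0).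
have B2 : `|q * S| <= T / (2 * d) + d / 2 * S.
  rewrite -imE; apply: bound => m.
  by have := young_weighted (b m) (- a m) (x m) (y m) d0; rewrite sqrrN addrC [b m ^+ 2 + _]addrC addrC.
rewrite reE in B1.
have main : d * S <= T / (2 * d) + d / 2 * S.
  case: hd => hd.
    apply: (le_trans _ B2); rewrite normrM (ger0_norm S0); exact: ler_wpM2r.
  apply: (le_trans _ B1).
  have HW' : `|pi^-1 * W| <= S.
    rewrite normrM gtr0_norm ?invr_gt0// mulrC ler_pdivrMr// mulrC//.
  have := lerB_dist (p * S) (pi^-1 * W); rewrite normrM (ger0_norm S0).
  have : d * S <= (`|p| - 1) * S by exact: ler_wpM2r.
  lra.
have : T / (2 * d) * (2 * d) = T by rewrite divfK//; lra.
nra.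
Qed.

(** * Passage to the principal value and the final estimate *)

(** A bound uniform in small [eps] survives the limit; the factor 2 comes from adding the squares of
    the two components. *)
Lemma pv_integral_close (R : realType) (a b x c : R) (g : R -> R[i])
    (l w : R[i]) (B : R) : 0 < c ->
  is_pv_integral a b x g l ->
  (forall eps : R, 0 < eps < c ->
    let I := cintegral [set y | a < y < b /\ eps < `|y - x|]%classic g in
    `|complex.Re I - complex.Re w| <= B /\ `|complex.Im I - complex.Im w| <= B) ->
  cmod (l - w) ^+ 2 <= 2 * B ^+ 2.
Proof.
move=> c0 pvl HI.
have Il := (@cvgrPdist_le R[i] (R[i]^o) _ _ _ _ _).1 pvl.
have ReE (z z' : R[i]) : complex.Re (z + (z' - w))
    = complex.Re z + (complex.Re z' - complex.Re w) by case: z; case: z'; case: (w).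
have ImE (z z' : R[i]) : complex.Im (z + (z' - w))
    = complex.Im z + (complex.Im z' - complex.Im w) by case: z; case: z'; case: (w).
have key (e : R) : 0 < e ->
    `|complex.Re (l - w)| <= B + e /\ `|complex.Im (l - w)| <= B + e.
  move=> e0.
  have e0' : 0 < (e%:C : R[i]) by rewrite ltcR.
  have H : ((0 : R)^'+)%classic [set eps | (`|l - cintegral
      [set y | a < y < b /\ eps < `|y - x|]%classic g| <= e%:C) /\
      (0 < eps /\ eps < c)]%classic.
    apply: filterI; first exact: Il.
    by apply: filterI; [exact: nbhs_right_gt|exact: nbhs_right_lt].
  have [eps [Heps [eps0 epsc]]] := filter_ex H.
  have := HI eps; rewrite eps0 epsc => /(_ isT) /=.
  move: Heps; set I := cintegral _ _ => Heps [h1 h2].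
  have {}Heps : cmod (l - I) <= e by move: Heps; rewrite -lecR.
  have [r1 r2] := ReIm_le_cmod (l - I).
  have lwE : l - w = (l - I) + (I - w) by rewrite subrKA.
  split; rewrite lwE; [rewrite ReE|rewrite ImE].
    by apply: (le_trans (ler_normD _ _)); rewrite [leRHS]addrC lerD// (le_trans r1).
  by apply: (le_trans (ler_normD _ _)); rewrite [leRHS]addrC lerD// (le_trans r2).
have h1 : `|complex.Re (l - w)| <= B by apply/ler_addgt0Pr => e /key[].
have h2 : `|complex.Im (l - w)| <= B by apply/ler_addgt0Pr => e /key[].
have B0 : 0 <= B by apply: le_trans h1.
rewrite cmodE mulr_natl mulr2n -[X in X + _]real_normK ?num_real//.
rewrite -[X in _ + X]real_normK ?num_real//.
by apply: lerD; rewrite ler_pXn2r ?nnegrE.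
Qed.

Lemma ln_nat_ge_half (R : realType) (N : nat) : (2 <= N)%N -> 2^-1 <= ln N%:R :> R.
Proof.
move=> N2; apply: (@le_trans _ _ (ln 2)).
  have := @ln_diff_bounds R 1 2 ltac:(lra) ltac:(lra).
  by rewrite ln1; lra.
by rewrite ler_ln ?posrE ?ltr0n ?ler_nat// (leq_trans _ N2).
Qed.

Lemma consistency_error (R : realType) (a b al K : R) (u : R -> R[i])
    (N M : nat) (m : 'I_M) (l : R[i]) :
  a < b -> 2^-1 < al <= 1 ->
  (forall y z, a <= y <= b -> a <= z <= b -> cmod (u y - u z) <= K * `|y - z| `^ al) ->
  u a = 0 -> u b = 0 -> (2 <= N)%N -> M%:R = N%:R * (b - a) ->
  is_pv_integral a b (midpoint a N m)
    (fun y => u y / ('i%C * pi%:C * (midpoint a N m - y)%:C)) l ->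
  cmod (l - ('i%C * pi%:C * N%:R)^-1
    * (\sum_(n < M | n != m) u (midpoint a N n) / (midpoint a N m - midpoint a N n)%:C)) ^+ 2
  <= 2 * (`|K| / pi * (18 + 12 * (b - a)) * N%:R `^ (- al) * ln N%:R) ^+ 2.
Proof.
move=> ab al01 uH ua ub N2 MN pvl.
have N0 : (0 < N)%N by exact: leq_trans N2.
have Nr : 0 < N%:R :> R by rewrite ltr0n.
have pi0 := pi_gt0 R.
have K0 : 0 <= `|K| / pi by rewrite divr_ge0// ltW.
rewrite (discrete_operatorE a (fun n => u (midpoint a N n)))//.
set B := `|K| / pi * _ * _ * _.
have BE : `|K| / pi * N%:R^-1 `^ al * (12 + 6 * ln M%:R) <= B.
  have <- : N%:R `^ (- al) = N%:R^-1 `^ al :> R.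
    by rewrite -powR_inv1// -powRrM mulN1r.
  have -> : B = `|K| / pi * N%:R `^ (- al) * ((18 + 12 * (b - a)) * ln N%:R).
    by rewrite /B; ring.
  apply: ler_wpM2l; first by rewrite mulr_ge0 ?powR_ge0.
  rewrite MN lnM ?posrE ?subr_gt0//.
  (* Here [ln M = ln N + ln (b - a)] with [ln (b - a) <= b - a - 1]; then [1 <= 2 * ln N] turns
     [6 + 6 * (b - a) + 6 * ln N] into [(18 + 12 * (b - a)) * ln N]. *)
  have := @ln_le_subr1 R (b - a); rewrite subr_gt0 => /(_ ab).
  by have := ln_nat_ge_half R N2; nra.
have vH (v : R -> R) : (forall y z, `|v y - v z| <= cmod (u y - u z) / pi) ->
    forall y z, a <= y <= b -> a <= z <= b -> `|v y - v z| <= `|K| / pi * `|y - z| `^ al.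
  move=> H y z yab zab; apply: (le_trans (H y z)).
  rewrite mulrAC ler_wpM2r ?invr_ge0 ?(ltW pi0)//.
  by apply: (le_trans (uH _ _ yab zab)); rewrite ler_wpM2r ?powR_ge0// ler_norm.
have normpi (t : R) : `|t / pi| = `|t| / pi by rewrite normrM normfV (gtr0_norm pi0).
apply: (pv_integral_close (c := N%:R^-1 / 2) _ pvl).
  by rewrite divr_gt0// invr_gt0.
move=> eps eh /=; split.
  have -> : (fun y => complex.Re (u y / ('i%C * pi%:C * (midpoint a N m - y)%:C)))
     = (fun y => (complex.Im (u y) / pi) / (midpoint a N m - y)).
    by apply/funext => y; rewrite div_i_real.
  apply: le_trans BE.
  apply: (real_consistency (v := fun y => complex.Im (u y) / pi)) => //.
  - apply: vH => y z; rewrite -mulrBl normpi ler_wpM2r ?invr_ge0 ?(ltW pi0)//.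
    have [_] := ReIm_le_cmod (u y - u z).
    by case: (u y) => ? ?; case: (u z).
  - by rewrite ua mul0r.
  - by rewrite ub mul0r.
have -> : (fun y => complex.Im (u y / ('i%C * pi%:C * (midpoint a N m - y)%:C)))
   = (fun y => (- complex.Re (u y) / pi) / (midpoint a N m - y)).
  by apply/funext => y; rewrite div_i_real.
apply: le_trans BE.
apply: (real_consistency (v := fun y => - complex.Re (u y) / pi)) => //.
- apply: vH => y z; rewrite -mulrBl -opprD mulNr normrN normpi.
  rewrite ler_wpM2r ?invr_ge0 ?(ltW pi0)//.
  have [+ _] := ReIm_le_cmod (u y - u z).
  by case: (u y) => ? ?; case: (u z).
- by rewrite ua oppr0 mul0r.
- by rewrite ub oppr0 mul0r.
Qed.

Theorem theorem3p3 (R : realType) (a b : R) (lambda : R[i]) (alpha : R)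
    (u f : R -> R[i])
    (hab : a < b)
    (hlambda : forall t : R, -1 <= t <= 1 -> lambda <> t%:C)
    (halpha : 2^-1 < alpha <= 1)
    (hholder : holder_continuous alpha a b u)
    (hua : u a = 0) (hub : u b = 0)
    (hu : solves_singular_equation a b lambda u f) :
  exists C : R,
    forall (N M : nat) (v : 'I_M -> R[i]),
      (2 <= N)%N -> (0 < M)%N -> M%:R = N%:R * (b - a) ->
      solves_discrete_system a lambda N f v ->
      l2norm (fun m : 'I_M => u (midpoint a N m) - v m)
        <= C * N%:R `^ (2^-1 - alpha) * ln N%:R.
Proof.
have [K uH] := hholder.
have [d d0 stab] := discrete_stability hlambda.
pose C1 := `|K| / pi * (18 + 12 * (b - a)).
(* [d^-1] is the stability constant and [C1] the consistency constant at one node; [2 * (b - a)]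
   combines the factor 2 of the squared bound with the node count [M = N * (b - a)], whose remaining
   [N] yields [N^(1/2)]. *)
exists (d^-1 * (Num.sqrt (2 * (b - a)) * C1)) => N M v N2 M0 MN hv.
have N0 : (0 < N)%N by exact: leq_trans N2.
have Nr : 0 < N%:R :> R by rewrite ltr0n.
have Mr : 0 < M%:R :> R by rewrite ltr0n.
have C10 : 0 <= C1.
  by rewrite /C1 mulr_ge0 ?divr_ge0 ?pi_ge0//; lra.
have ln0 : 0 <= ln N%:R :> R by have := ln_nat_ge_half R N2; lra.
pose E m := u (midpoint a N m) - v m.
pose T (z : 'I_M -> R[i]) m := ('i%C * pi%:C * N%:R)^-1
  * (\sum_(n < M | n != m) z n / (midpoint a N m - midpoint a N n)%:C).
pose r m := lambda * E m - T E m.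
have TB z z' m : T (fun n => z n - z' n) m = T z m - T z' m.
  rewrite /T -mulrBr -sumrB; congr (_ * _); apply: eq_bigr => n _.
  by rewrite mulrBl.
have Er m : lambda * E m -
       ((\sum_(n < M | n != m) complex.Im (E n) / pi / (m%:R - n%:R))
        +i* (\sum_(n < M | n != m) - complex.Re (E n) / pi / (m%:R - n%:R)))
       = r m.
  by rewrite /r /T discrete_operatorE.
have {}stab := stab M E r Er.
have rH m : cmod (r m) ^+ 2 <= 2 * (C1 * N%:R `^ (- alpha) * ln N%:R) ^+ 2.
  have mab : a < midpoint a N m < b.
    have mM := ltn_ord m.
    have mr : 0 <= m%:R :> R by [].
    have : b = a + M%:R * N%:R^-1 by rewrite MN mulrAC mulfV ?gt_eqF// mul1r addrC subrK.
    move=> bE; rewrite /midpoint bE ltrDl ltrD2l ltr_pM2r ?invr_gt0//.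
    rewrite pmulr_lgt0 ?invr_gt0// -natr1.
    have : m.+1%:R <= M%:R :> R by rewrite ler_nat.
    by rewrite -natr1; lra.
  have [l [pvl lE]] := hu _ mab.
  have := consistency_error hab halpha uH hua hub N2 MN pvl.
  (* Subtracting the discrete equation from the integral equation at the node eliminates [f], so the
     residual is exactly the quadrature error of [u]. *)
  suff -> : r m = l - T (fun n => u (midpoint a N n)) m by [].
  have := hv m; rewrite -/(T v m) -lE /r /E TB => hvm.
  rewrite mulrBr; move: hvm; set A := lambda * _; set A' := lambda * _.
  set t := T _ _; set t' := T _ _ => hvm.
  have -> : A = A' - l + t by rewrite -hvm subrK.
  ring.
have SH : \sum_m cmod (E m) ^+ 2 <= d ^- 2 * (2 * M%:R * (C1 * N%:R `^ (- alpha) * ln N%:R) ^+ 2).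
  rewrite -ler_pdivrMl ?invr_gt0 ?exprn_gt0// invrK.
  apply: (le_trans stab); apply: (le_trans (ler_sum _ (fun m _ => rH m))).
  rewrite sumr_const card_ord -[leLHS]mulr_natl; lra.
rewrite /l2norm -[leRHS]ger0_norm; last first.
  apply: mulr_ge0 => //; apply: mulr_ge0; last exact: powR_ge0.
  apply: mulr_ge0; first by rewrite invr_ge0 ltW.
  by apply: mulr_ge0 => //; exact: sqrtr_ge0.
rewrite -sqrtr_sqr ler_wsqrtr// (le_trans SH)//.
have -> : N%:R `^ (2^-1 - alpha) = N%:R `^ 2^-1 * N%:R `^ (- alpha) :> R.
  by apply: powRD; apply/implyP => _; rewrite gt_eqF.
rewrite MN powR12_sqrt ?(ltW Nr)// !exprMn !sqr_sqrtr ?(ltW Nr)//; last by lra.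
by rewrite !exprVn le_eqVlt; apply/orP; left; apply/eqP; ring.
Qed.
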